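(* Let $A$ be a $C^*$-algebra, $H$ a Hilbert $A$-module, and let $P,Q\in\mathcal{L}(H)$ be two projections such that $\mathcal{R}(P)\cap\mathcal{R}(Q)$ and $\mathcal{N}(P)\cap\mathcal{N}(Q)$ are both orthogonally complemented in $H$. Then $$\big\Vert PQ\big(I-P_{\mathcal{R}(P)\cap\mathcal{R}(Q)}\big)\big\Vert=\big\Vert(I-P)(I-Q)\big(I-P_{\mathcal{N}(P)\cap\mathcal{N}(Q)}\big)\big\Vert.$$
   Context: $\mathcal{L}(H)$ is the $C^*$-algebra of adjointable operators on the Hilbert $A$-module $H$; a projection is $P\in\mathcal{L}(H)$ with $P=P^2=P^*$; $\mathcal{R}$ and $\mathcal{N}$ denote range and null space. A closed submodule $M\subseteq H$ is orthogonally complemented in $H$ if $H=M+M^\perp$, where $M^\perp=\{x\in H:\langle x,y\rangle=0\ \forall y\in M\}$; then $P_M$ denotes the projection in $\mathcal{L}(H)$ with range $M$. *)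

(* Defs.v *)
From HB Require Import structures.
From mathcomp Require Import all_boot all_order all_algebra.
From mathcomp Require Import complex.
From mathcomp Require Import all_classical all_reals all_analysis.

Set Implicit Arguments.
Unset Strict Implicit.
Unset Printing Implicit Defensive.

Import Order.TTheory GRing.Theory Num.Theory.
Import numFieldNormedType.Exports.

Local Open Scope classical_set_scope.
Local Open Scope complex_scope.
Local Open Scope ring_scope.

(* The scalars are R[i], for R a realType, and norms are (real) elements of
   R[i]. A C*-algebra need not have a unit, so its product cannot be the one
   of a ringType. *)
HB.mixin Record isCstarAlgebra (R : realType) A
    of CompleteNormedModule R[i] A := {
  cmul : A -> A -> A ;
  cstar : A -> A ;
  cmulA : forall a b c : A, cmul a (cmul b c) = cmul (cmul a b) c ;
  cmulDl : forall a b c : A, cmul (a + b) c = cmul a c + cmul b c ;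
  cmulDr : forall a b c : A, cmul a (b + c) = cmul a b + cmul a c ;
  cmulZl : forall (z : R[i]) (a b : A), cmul (z *: a) b = z *: cmul a b ;
  cmulZr : forall (z : R[i]) (a b : A), cmul a (z *: b) = z *: cmul a b ;
  cnormM : forall a b : A, `|cmul a b| <= `|a| * `|b| ;
  cstarK : forall a : A, cstar (cstar a) = a ;
  cstarD : forall a b : A, cstar (a + b) = cstar a + cstar b ;
  cstarZ : forall (z : R[i]) (a : A), cstar (z *: a) = conjc z *: cstar a ;
  cstarM : forall a b : A, cstar (cmul a b) = cmul (cstar b) (cstar a) ;
  cstar_norm : forall a : A, `|cmul (cstar a) a| = `|a| ^+ 2
}.

#[short(type="cstarAlgebraType")]
HB.structure Definition CstarAlgebra (R : realType) :=
  {A of isCstarAlgebra R A & CompleteNormedModule R[i] A}.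

Definition cpositive (R : realType) (A : cstarAlgebraType R) (a : A) : Prop :=
  exists b : A, a = cmul (cstar b) b.

(* Right modules; the inner product is A-linear in its second variable. *)
HB.mixin Record isHilbertModule (R : realType) (A : cstarAlgebraType R) H
    of CompleteNormedModule R[i] H := {
  ract : H -> A -> H ;
  inner : H -> H -> A ;
  ractDl : forall (x y : H) (a : A), ract (x + y) a = ract x a + ract y a ;
  ractDr : forall (x : H) (a b : A), ract x (a + b) = ract x a + ract x b ;
  ractM : forall (x : H) (a b : A), ract x (cmul a b) = ract (ract x a) b ;
  ractZl : forall (z : R[i]) (x : H) (a : A),
    ract (z *: x) a = z *: ract x a ;
  ractZr : forall (z : R[i]) (x : H) (a : A),
    ract x (z *: a) = z *: ract x a ;
  innerDr : forall x y z : H, inner x (y + z) = inner x y + inner x z ;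
  innerZr : forall (z : R[i]) (x y : H), inner x (z *: y) = z *: inner x y ;
  inner_ract : forall (x y : H) (a : A),
    inner x (ract y a) = cmul (inner x y) a ;
  innerC : forall x y : H, cstar (inner x y) = inner y x ;
  inner_ge0 : forall x : H, cpositive (inner x x) ;
  inner_eq0 : forall x : H, inner x x = 0 -> x = 0 ;
  hnormE : forall x : H, `|x| ^+ 2 = `|inner x x|
}.

#[short(type="hilbertModuleType")]
HB.structure Definition HilbertModule (R : realType) (A : cstarAlgebraType R) :=
  {H of isHilbertModule R A H & CompleteNormedModule R[i] H}.

Section Operators.
Context {R : realType} {A : cstarAlgebraType R} {H : hilbertModuleType A}.
Implicit Types (S T : H -> H) (M N : set H) (x y : H).

Definition is_adjoint T S : Prop :=
  forall x y, inner (T x) y = inner x (S y) :> A.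

Definition adjointable T : Prop := exists S, is_adjoint T S.

Definition is_projection T : Prop :=
  [/\ adjointable T, T \o T = T & is_adjoint T T].

(* Adjointable operators are bounded, so for them this sup is not the default
   value of an unbounded set; `|T x| is a real element of R[i]. *)
Definition op_norm T : R :=
  sup [set complex.Re `|T x| | x in [set x : H | `|x| <= 1]].

Definition null_space T : set H := [set x | T x = 0].

Definition orth M : set H :=
  [set x | forall y, M y -> inner x y = 0 :> A].

Definition orth_complemented M : Prop :=
  forall x, exists y z, [/\ M y, orth M z & x = y + z].

(* P_M; a junk value when no projection has range M. *)
Definition proj_on M : H -> H :=
  xget (fun=> 0) [set T : H -> H | is_projection T /\ range T = M].

Definition op_compl T : H -> H := fun x => x - T x.

Lemma inner0r x : inner x 0 = 0 :> A.
Proof. by rewrite -(scale0r (0 : H)) innerZr scale0r. Qed.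

Lemma innerNr x y : inner x (- y) = - inner x y :> A.
Proof. by rewrite -scaleN1r innerZr scaleN1r. Qed.

Lemma innerBr x y z : inner x (y - z) = inner x y - inner x z :> A.
Proof. by rewrite innerDr innerNr. Qed.

Lemma inner_eq0C x y : inner x y = 0 :> A -> inner y x = 0 :> A.
Proof.
move=> xy0; rewrite -innerC xy0.
by rewrite -(scale0r (0 : A)) cstarZ rmorph0 !scale0r.
Qed.

Lemma proj_onP M : M 0 -> (forall x y, M x -> M y -> M (x - y)) ->
  orth_complemented M ->
  is_projection (proj_on M) /\ range (proj_on M) = M.
Proof.
move=> M0 MB cM.
have /choice[T HT] : forall x, exists y, M y /\ orth M (x - y).
  move=> x; have [y [z [My oz ->]]] := cM x.
  by exists y; split => //; rewrite addrC addKr.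
have TM x : M x -> T x = x.
  move=> Mx; have [MTx oTx] := HT x.
  by apply/eqP; rewrite eq_sym -subr_eq0; apply/eqP/(@inner_eq0 R A)/oTx/MB.
have adjT : is_adjoint T T.
  move=> x y; have [MTx oTx] := HT x; have [MTy oTy] := HT y.
  have -> : inner (T x) y = inner (T x) (T y) :> A.
    by apply/eqP; rewrite -subr_eq0 -innerBr; apply/eqP/inner_eq0C/oTy.
  apply/esym; rewrite -innerC -[RHS]innerC; congr cstar.
  by apply/eqP; rewrite -subr_eq0 -innerBr; apply/eqP/inner_eq0C/oTx.
suff : [set T : H -> H | is_projection T /\ range T = M] (proj_on M) by [].
apply: (@xgetPex _ _ [set T : H -> H | is_projection T /\ range T = M]).
exists T; split; first split => //.
- by exists T.
- by apply/funext => x /=; rewrite TM//; have [] := HT x.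
- apply/seteqP; split => [_ [x _ <-]|x Mx]; first by have [] := HT x.
  by exists x => //; rewrite TM.
Qed.

End Operators.

(* Main.v *)
(** Replacing [P, Q] by [I - P, I - Q] exchanges the two sides, so one inequality
suffices. Let [s < 1] be the right-hand side. On [R(Q)] put [B = QPQ] and
[X = (I - Q) P], and on [N(Q)] put [B' = (I - Q)(I - P)]. Then [X B = B' X] and
[B - B^2 = Q P X], while [B'] contracts by [s^2] the part of [N(Q)] orthogonal to
[N(P)] and [N(Q)]. For [y] in [R(Q)] orthogonal to the intersection of [R(P)] and
[R(Q)], the differences [B^n y - B^(n+1) y] thus decay like [s^(2n)]. The limit of
[B^n y] is fixed by [B], so it lies in both ranges and must vanish; hence [B^n y]
itself is [O(s^(2n))]. As [|B^n y|] is log-convex in [n], this gives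
[|B y| <= s^2 |y|], that is [|P y| <= s |y|].

The Cauchy-Schwarz inequality for the Hilbert module norm is obtained without
the order theory of C*-algebras, from the triangle inequality and isometric
perturbations [x + y a] of [x]. *)
Require Import Defs.
From mathcomp Require Import all_boot all_order all_algebra.
From mathcomp Require Import complex.
From mathcomp Require Import all_classical all_reals all_analysis.
From mathcomp Require Import ring lra.

Set Implicit Arguments.
Unset Strict Implicit.
Unset Printing Implicit Defensive.

Import Order.TTheory GRing.Theory Num.Theory.
Import numFieldNormedType.Exports.

Local Open Scope classical_set_scope.
Local Open Scope complex_scope.
Local Open Scope ring_scope.

(* The norm of the modules takes its values in [R[i]]; [nm] is the same number in [R]. *)
Section RealNorm.
Context {R : realType} {V : normedModType R[i]}.
Implicit Types x y : V.

Definition nm x : R := complex.Re `|x|.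

Lemma nmE x : `|x| = (nm x)%:C.
Proof. by rewrite RRe_real// ger0_real. Qed.

Lemma nm_ge0 x : 0 <= nm x.
Proof. by rewrite -ler0c -nmE. Qed.

Lemma nm_eq0 x : nm x = 0 -> x = 0.
Proof. by move=> x0; apply/eqP; rewrite -normr_eq0 nmE x0. Qed.

Lemma nm0 : nm 0 = 0.
Proof. by rewrite /nm normr0. Qed.

Lemma nmN x : nm (- x) = nm x.
Proof. by rewrite /nm normrN. Qed.

Lemma nmBC x y : nm (x - y) = nm (y - x).
Proof. by rewrite /nm distrC. Qed.

Lemma nmD x y : nm (x + y) <= nm x + nm y.
Proof. by have := ler_normD x y; rewrite !nmE -rmorphD lecR. Qed.

Lemma nmB x y : nm (x - y) <= nm x + nm y.
Proof. by rewrite -(nmN y) nmD. Qed.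

Lemma nmZ (z : R[i]) x : nm (z *: x) = complex.Re `|z| * nm x.
Proof. by rewrite /nm normrZ !normc_def; case: `|x| => a b /=; rewrite mul0r subr0. Qed.

Lemma nmZr (t : R) x : 0 <= t -> nm (t%:C *: x) = t * nm x.
Proof. by move=> t0; rewrite nmZ normc_def/= expr0n addr0 sqrtr_sqr ger0_norm. Qed.

Lemma nmZi x : nm ('i *: x) = nm x.
Proof. by rewrite nmZ normc_def/= expr0n expr1n add0r sqrtr1 mul1r. Qed.

End RealNorm.

(** * Geometric convergence, contractions and resolvents in complete spaces *)

Lemma expr_lt_eps (R : realType) (r e : R) : 0 <= r -> r < 1 -> 0 < e ->
  exists N, forall n, (N <= n)%N -> r ^+ n < e.
Proof.
move=> r0 r1 e0.
have /cvgrPdist_lt h : (fun n => r ^+ n) @ \oo --> (0 : R).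
  by apply: cvg_expr; rewrite ger0_norm.
have [N _ HN] := h e e0; exists N => n Nn.
by have := HN n Nn; rewrite /= sub0r normrN ger0_norm// exprn_ge0.
Qed.

Lemma le_eps (R : realType) (a b : R) : (forall e, 0 < e -> a <= b + e) -> a <= b.
Proof. by move=> h; apply/ler_addgt0Pr. Qed.

Lemma geometric_limit (R : realType) (V : completeNormedModType R[i])
    (u : nat -> V) (c r : R) : 0 <= r -> r < 1 ->
  (forall n, nm (u n.+1 - u n) <= c * r ^+ n) ->
  exists l, forall n, nm (l - u n) <= c * r ^+ n / (1 - r).
Proof.
move=> r0 r1 du.
have r1' : 0 < 1 - r by lra.
have c0 : 0 <= c by have := du 0%N; rewrite expr0 mulr1; apply/le_trans/nm_ge0.
(* The bound is the sum of [k] consecutive terms of the geometric series, starting at index [n]. *)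
have H n k : nm (u (n + k)%N - u n) <= c * r ^+ n * (1 - r ^+ k) / (1 - r).
  rewrite ler_pdivlMr//; elim: k => [|k IH].
    by rewrite addn0 subrr nm0 mul0r subrr mulr0.
  have := nmD (u (n + k).+1 - u (n + k)%N) (u (n + k)%N - u n).
  rewrite addnS addrA subrK => /(ler_wpM2r (ltW r1'))/le_trans; apply.
  have := ler_wpM2r (ltW r1') (du (n + k)%N).
  rewrite exprD exprS; nra.
have H2 n k : nm (u (n + k)%N - u n) <= c * r ^+ n / (1 - r).
  apply: le_trans (H n k) _; rewrite ler_pM2r ?invr_gt0// ler_piMr//.
    by rewrite mulr_ge0// exprn_ge0.
  by rewrite gerBl exprn_ge0.
have small e : 0 < e -> exists N, c * r ^+ N / (1 - r) < e.
  move=> e0; have d0 : 0 < e * (1 - r) / (c + 1) by rewrite divr_gt0 ?mulr_gt0//; lra.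
  have [N /(_ N (leqnn _))] := expr_lt_eps r0 r1 d0; exists N.
  rewrite ltr_pdivrMr//; apply: le_lt_trans (_ : (c + 1) * r ^+ N < _).
    by rewrite ler_wpM2r ?exprn_ge0//; lra.
  by rewrite mulrC -ltr_pdivlMr//; lra.
have : cvg (u @ \oo).
  apply/cauchy_cvgP/cauchy_exP => e e0.
  (* A positive element of [R[i]] is real, so [e] is the image of its real part. *)
  have e0' : 0 < complex.Re e by move: e0; rewrite ltcE => /andP[].
  have eE : e = (complex.Re e)%:C by rewrite RRe_real// gtr0_real.
  have [N HN] := small _ e0'; exists (u N); exists N => // n /= Nn.
  rewrite -ball_normE/= nmE eE ltcR nmBC -(subnKC Nn).
  exact: le_lt_trans (H2 _ _) HN.
move=> /cvg_ex[l ul]; exists l => n.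
apply: le_eps => e e0.
have e0' : 0 < e%:C by rewrite ltcR.
have /cvgrPdist_lt ul' := ul; have [N _ HN] := ul' _ e0'.
have /= := HN (n + N)%N (leq_addl _ _); rewrite nmE ltcR => h.
have := nmD (l - u (n + N)%N) (u (n + N)%N - u n).
rewrite addrA subrK; have := H2 n N; lra.
Qed.

(** Banach's argument with ratio 1/2: the iterates of [0] move by at most [nm (f 0) * 2^-1 ^+ n]. *)
Lemma contraction_fixed (R : realType) (V : completeNormedModType R[i]) (f : V -> V) :
  (forall x y, nm (f x - f y) <= nm (x - y) / 2) -> exists x, f x = x.
Proof.
move=> fc.
have half0 : 0 <= (2^-1 : R) by lra.
have half1 : (2^-1 : R) < 1 by lra.
have [|l Hl] := geometric_limit half0 half1 (u := fun n => iter n f 0) (c := nm (f 0)).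
  elim=> [|n IH] /=; first by rewrite subr0 expr0 mulr1.
  by apply: le_trans (fc _ _) _; rewrite exprSr /=; move: IH; rewrite /=; lra.
exists l; apply/eqP; rewrite -subr_eq0; apply/eqP/nm_eq0/le_anti; rewrite nm_ge0 andbT.
apply: le_eps => e e0; rewrite add0r.
(* Both distances to [iter N.+1 f 0] below are at most [nm (f 0) * 2^-1 ^+ N]; the added [1] keeps
   the denominator positive. *)
have d0 : 0 < e / (4 * (nm (f 0) + 1)).
  by rewrite divr_gt0// mulr_gt0//; have := nm_ge0 (f 0); lra.
have [N /(_ N (leqnn _)) hN] := expr_lt_eps half0 half1 d0.
have := nmD (f l - iter N.+1 f 0) (iter N.+1 f 0 - l).
rewrite addrA subrK => /le_trans; apply.
have h1 := fc l (iter N f 0); have h2 := Hl N; have := Hl N.+1.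
rewrite nmBC exprS; move: hN; rewrite ltr_pdivlMr; last first.
  by have := nm_ge0 (f 0); lra.
have : 0 <= (2^-1 : R) ^+ N by rewrite exprn_ge0//; lra.
rewrite /= in h1 *; have := nm_ge0 (f 0).
rewrite (_ : 1 - 2^-1 = 2^-1 :> R) in h2 *; last by lra.
rewrite !invrK in h2 *.
set q := _ ^+ N in h2 *; nra.
Qed.

(* The symmetry of the norms of [L x +- i d x] gives [d |x| <= |L x + i d x|], which
   lets surjectivity propagate from [d] to [d / 2]. *)
Lemma resolvent_surj (R : realType) (V : completeNormedModType R[i])
    (L : V -> V) (M : R) : 0 < M ->
  (forall x y, L (x - y) = L x - L y) ->
  (forall x, nm (L x) <= M * nm x) ->
  (forall (d : R) x, nm (L x - 'i *: (d%:C *: x)) = nm (L x + 'i *: (d%:C *: x))) ->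
  forall e : R, 0 < e ->
  exists2 d : R, 0 < d < e & forall z, exists x, L x + 'i *: (d%:C *: x) = z.
Proof.
move=> M0 LB LM Lsym e e0.
pose surj (d : R) := forall z, exists x, L x + 'i *: (d%:C *: x) = z.
have bound (d : R) x : 0 <= d -> d * nm x <= nm (L x + 'i *: (d%:C *: x)).
  move=> d0; have := nmB (L x + 'i *: (d%:C *: x)) (L x - 'i *: (d%:C *: x)).
  rewrite Lsym opprB [X in nm X]addrC addrA subrK -scalerDr nmZi -scalerDl.
  by rewrite -rmorphD nmZr ?addr_ge0//; lra.
(* For [d = 2 * M] the equation reads [x = d^-1 (- i) (z - L x)], whose right-hand side contracts by
   1/2 because [L] is bounded by [M]. *)
have base : surj (2 * M).
  move=> z; have [x y|x xE] := @contraction_fixed R V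
      (fun x => (2 * M)^-1%:C *: (- 'i *: (z - L x))).
    rewrite -!scalerBr opprB [X in _ *: (_ *: X)]addrC addrA subrK -LB.
    rewrite nmZr; last by rewrite invr_ge0; lra.
    rewrite scaleNr nmN nmZi.
    rewrite [leLHS]mulrC ler_pdivrMr ?mulr_gt0//.
    by have := LM (y - x); rewrite (nmBC y); lra.
  have M2 : (2 * M)%:C != 0 :> R[i].
    by rewrite -(rmorph0 (real_complex R)) (inj_eq (@complexI R)); lra.
  exists x; rewrite -[X in _ *: (_ *: X)]xE.
  rewrite (scalerA (2 * M)%:C) fmorphV mulfV// scale1r.
  by rewrite scalerA mulrN -expr2 sqr_i opprK scale1r addrC subrK.
(* With [S] a right inverse at [d], a solution at [d / 2] is a fixed point of
   [x |-> S (z + i (d / 2) x)]. By [bound], [S] is Lipschitz with constant [1 / d], so this map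
   contracts by 1/2. *)
have half d : 0 < d -> surj d -> surj (d / 2).
  move=> d0 /choice[S HS] z.
  have [x y|x xE] := @contraction_fixed R V
      (fun x => S (z + 'i *: ((d / 2)%:C *: x))).
    set u := z + _; set v := z + _.
    have := bound d (S u - S v) (ltW d0).
    rewrite LB 2!scalerBr addrACA -opprD !HS.
    rewrite /u /v opprD addrACA subrr add0r -!scalerBr nmZi nmZr; last by lra.
    nra.
  exists x; have := HS (z + 'i *: ((d / 2)%:C *: x)); rewrite xE.
  have -> : d%:C = (d / 2)%:C + (d / 2)%:C by rewrite -rmorphD -splitr.
  rewrite scalerDl scalerDr addrA.
  exact: addIr.
have all n : surj (2 * M * 2^-1 ^+ n).
  elim: n => [|n IH]; first by rewrite expr0 mulr1.
  rewrite exprSr mulrA; apply: half => //.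
  by rewrite !mulr_gt0// exprn_gt0.
have half0 : 0 <= (2^-1 : R) by lra.
have half1 : (2^-1 : R) < 1 by lra.
have e0' : 0 < e / (2 * M) by rewrite divr_gt0 ?mulr_gt0.
have [N /(_ N (leqnn _)) hN] := expr_lt_eps half0 half1 e0'.
exists (2 * M * 2^-1 ^+ N); last exact: all.
rewrite !mulr_gt0 ?exprn_gt0//=.
by rewrite mulrC -ltr_pdivlMr// mulr_gt0.
Qed.

(** * Conjugation of scalars and norms in a C*-algebra *)

Lemma conjci (R : realType) : conjc 'i = - 'i :> R[i].
Proof. by apply/eqP; rewrite eq_complex /= oppr0 !eqxx. Qed.

Lemma conjc_imaginary (R : realType) (d : R) : conjc ('i * d%:C) = - ('i * d%:C) :> R[i].
Proof.
apply/eqP; rewrite eq_complex /=.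
by rewrite !(mul0r, mulr0, mul1r, subr0, sub0r, add0r, addr0, oppr0) !eqxx.
Qed.

Section CstarNorm.
Context {R : realType} {A : cstarAlgebraType R}.
Implicit Types a b : A.

Lemma cmulNl a b : cmul (- a) b = - cmul a b.
Proof. by rewrite -scaleN1r cmulZl scaleN1r. Qed.

Lemma cmulNr a b : cmul a (- b) = - cmul a b.
Proof. by rewrite -scaleN1r cmulZr scaleN1r. Qed.

Lemma cstarN a : cstar (- a) = - cstar a.
Proof. by rewrite -scaleN1r cstarZ rmorphN1 scaleN1r. Qed.

Lemma nm_cmul a b : nm (cmul a b) <= nm a * nm b.
Proof. by have := cnormM a b; rewrite !nmE -rmorphM lecR. Qed.

Lemma nm_cstar_mul a : nm (cmul (cstar a) a) = nm a ^+ 2.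
Proof. by have := cstar_norm a; rewrite !nmE -rmorphXn => /complexI. Qed.

Lemma nm_cstar a : nm (cstar a) = nm a.
Proof.
suff le b : nm b <= nm (cstar b).
  by apply/le_anti; rewrite le andbT; have := le (cstar a); rewrite cstarK.
have := nm_cmul (cstar b) b; rewrite nm_cstar_mul expr2.
have := nm_ge0 b; rewrite le0r => /orP[/eqP-> _|b0]; first exact: nm_ge0.
by rewrite ler_pM2r.
Qed.

(** The cross terms cancel, so [a - b] and [a + b] have the same square [a^* a + b^* b]. This
    supplies the symmetry hypothesis of [resolvent_surj]. *)
Lemma nm_sub_add a b : cmul (cstar a) b + cmul (cstar b) a = 0 ->
  nm (a - b) = nm (a + b).
Proof.
move=> ab0; apply/eqP; rewrite -(@eqrXn2 _ 2) ?nm_ge0//; apply/eqP.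
have ba : cmul (cstar b) a = - cmul (cstar a) b by apply/eqP; rewrite -addr_eq0 addrC ab0.
rewrite -!nm_cstar_mul !(cstarD, cstarN) !(cmulDl, cmulDr, cmulNl, cmulNr) ba.
by rewrite opprB opprK [X in _ + X]addrC addrA subrK addrA addrK.
Qed.

End CstarNorm.

(** * The Cauchy-Schwarz inequality in a Hilbert module *)

Section Inner.
Context {R : realType} {A : cstarAlgebraType R} {H : hilbertModuleType A}.
Implicit Types (x y z : H) (a : A).

Lemma innerDl x y z : inner (x + y) z = inner x z + inner y z :> A.
Proof. by rewrite -innerC innerDr cstarD !innerC. Qed.

Lemma innerZl (t : R[i]) x y : inner (t *: x) y = conjc t *: inner x y :> A.
Proof. by rewrite -innerC innerZr cstarZ innerC. Qed.

Lemma innerNl x y : inner (- x) y = - inner x y :> A.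
Proof. by rewrite -innerC innerNr cstarN innerC. Qed.

Lemma innerBl x y z : inner (x - y) z = inner x z - inner y z :> A.
Proof. by rewrite innerDl innerNl. Qed.

Lemma inner_ractl x y a : inner (ract x a) y = cmul (cstar a) (inner x y) :> A.
Proof. by rewrite -innerC inner_ract cstarM innerC. Qed.

Lemma nm_sqr x : nm (inner x x : A) = nm x ^+ 2.
Proof. by have := hnormE x; rewrite !nmE -rmorphXn => /complexI. Qed.

Lemma inner_polar x y :
  inner x y *+ 4 = inner (x + y) (x + y) - inner (x - y) (x - y)
    - 'i *: (inner (x + 'i *: y) (x + 'i *: y) - inner (x - 'i *: y) (x - 'i *: y)) :> A.
Proof.
have polar (u v : H) : inner (u + v) (u + v) - inner (u - v) (u - v) =
    (inner u v + inner v u) *+ 2 :> A.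
  rewrite !(innerDl, innerDr, innerNl, innerNr).
  set a := inner u u; set b := inner u v; set c := inner v u; set d := inner v v.
  have -> : a - b - (c - d) = (a + d) - (b + c).
    by rewrite opprB addrACA opprD.
  rewrite [c + d]addrC addrACA.
  by rewrite opprB [LHS]addrC addrA subrK mulr2n.
rewrite !polar innerZl innerZr conjci scaleNr -scalerBr -scalerMnr scalerA -expr2 sqr_i.
by rewrite scaleN1r -mulrnBl opprK addrACA subrr addr0 -mulr2n -mulrnA.
Qed.

(** Polarization and the triangle inequality give [(1 + 1)^2 = 4] on unit vectors. The constant is
    harmless: it only enters an error term that vanishes with [d] in [cauchy_schwarz]. *)
Lemma nm_inner_le4 x y : nm (inner x y : A) <= 4 * nm x * nm y.
Proof.
have poly (u v : H) : nm (inner u v : A) <= (nm u + nm v) ^+ 2.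
  have sq (w : H) : nm w <= nm u + nm v -> nm (inner w w : A) <= (nm u + nm v) ^+ 2.
    by move=> h; rewrite nm_sqr lerXn2r// nnegrE ?addr_ge0 ?nm_ge0.
  have h1 := sq _ (nmD u v).
  have h2 := sq _ (nmB u v).
  have h3 : nm (inner (u + 'i *: v) (u + 'i *: v) : A) <= (nm u + nm v) ^+ 2.
    by apply: sq; rewrite -(nmZi v) nmD.
  have h4 : nm (inner (u - 'i *: v) (u - 'i *: v) : A) <= (nm u + nm v) ^+ 2.
    by apply: sq; rewrite -(nmZi v) nmB.
  have : nm (inner u v *+ 4 : A) = 4 * nm (inner u v : A).
    by rewrite -scaler_nat -(rmorph_nat (real_complex R)) nmZr.
  rewrite inner_polar.
  set p1 := inner (u + v) _ in h1 *; set p2 := inner (u - v) _ in h2 *.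
  set p3 := inner (u + _) _ in h3 *; set p4 := inner (u - _) _ in h4 *.
  have := nmB (p1 - p2) ('i *: (p3 - p4)); rewrite nmZi.
  have := nmB p1 p2; have := nmB p3 p4; lra.
have := nm_ge0 x; rewrite le0r => /orP[/eqP/nm_eq0 ->|x0].
  by rewrite (inner_eq0C (inner0r y)) !nm0 mulr0 mul0r.
have := nm_ge0 y; rewrite le0r => /orP[/eqP/nm_eq0 ->|y0].
  by rewrite inner0r !nm0 mulr0.
have := poly ((nm x)^-1%:C *: x) ((nm y)^-1%:C *: y).
rewrite innerZl innerZr conjc_real !nmZr ?invr_ge0 ?nm_ge0// !mulVf ?gt_eqF//.
rewrite mulrA -invfM [leLHS]mulrC ler_pdivrMr ?mulr_gt0// => /le_trans; apply.
by rewrite le_eqVlt; apply/orP; left; apply/eqP; ring.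
Qed.

(* [x + y a] has the same inner square as [x], so [|y a| <= 2 |x|]. Writing
   [<y,y> = b^* b], moreover [|b a| = |y a|], which bounds [g a] by [|x| |y|]. *)
Lemma cauchy_schwarz_approx (d : R) x y a (z := inner y x : A)
    (g := (2^-1)%:C *: (inner y y : A)) : 0 < d ->
  cmul g a + 'i *: (d%:C *: a) = - z ->
  nm z <= nm x * nm y + d * nm a /\ (d * nm a) ^+ 2 <= 10 * d * nm x ^+ 2.
Proof.
move=> d0; rewrite scalerA; set k := 'i * d%:C => aE.
have kJ : conjc k = - k := conjc_imaginary d.
have nk (V : normedModType R[i]) (v : V) : nm (k *: v) = d * nm v.
  by rewrite /k -scalerA nmZi nmZr// ltW.
have gJ : cstar g = g by rewrite /g cstarZ conjc_real innerC.
have gg : inner y y = g + g :> A.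
  by rewrite /g -scalerDl -rmorphD (_ : 2^-1 + 2^-1 = 1 :> R) ?scale1r//; lra.
have zE : z = - (cmul g a + k *: a) by rewrite aE opprK.
set X := nm x; set Y := nm y.
have X0 : 0 <= X := nm_ge0 x; have Y0 : 0 <= Y := nm_ge0 y.
have yaE : inner (ract y a) (ract y a) = cmul (cstar a) (cmul (inner y y) a) :> A.
  by rewrite inner_ract inner_ractl cmulA.
(* At [d = 0] with [<y,y>] invertible, [x + y a] is the reflection of [x] along [y], whence the
   factor 1/2 in [g]. In general the skew part [k] drops out of the cross terms, which sum to
   [- 2 a^* g a] and cancel [<y a, y a>]. *)
have iso : nm (x + ract y a) = X.
  apply/eqP; rewrite -(@eqrXn2 _ 2) ?nm_ge0//; apply/eqP; rewrite -!nm_sqr; congr nm.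
  rewrite innerDl !innerDr yaE inner_ract inner_ractl -[inner x y]innerC -/z.
  rewrite -addrA -[RHS]addr0; congr (_ + _).
  rewrite zE cstarN cstarD cstarZ cstarM gJ kJ gg.
  rewrite cmulNl cmulNr !(cmulDl, cmulDr, cmulZl, cmulZr, cmulNl, cmulNr) scaleNr -!cmulA.
  set u := _ *: cmul _ (cmul _ _); set v := k *: _.
  by rewrite opprB opprD [_ + (u + u)]addrACA addNr add0r addrACA subrr addNr addr0.
have ya2 : nm (ract y a) <= 2 * X.
  by have := nmB (x + ract y a) x; rewrite addrAC subrr add0r iso -/X; lra.
have [b bE] := inner_ge0 y.
have bY : nm b = Y.
  apply/eqP; rewrite -(@eqrXn2 _ 2) ?nm_ge0//; apply/eqP.
  by rewrite -nm_cstar_mul -bE nm_sqr.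
have baE : nm (cmul b a) = nm (ract y a).
  apply/eqP; rewrite -(@eqrXn2 _ 2) ?nm_ge0//; apply/eqP.
  by rewrite -nm_cstar_mul cstarM -nm_sqr yaE bE !cmulA.
have ga : nm (cmul g a) <= X * Y.
  have := nm_cmul (cstar b) (cmul b a); rewrite nm_cstar bY baE cmulA -bE.
  rewrite /g cmulZl nmZr ?invr_ge0//; nra.
split.
  by rewrite zE nmN; have := nmD (cmul g a) (k *: a); rewrite nk; lra.
(* In [(k a)^* (k a)] the second factor is replaced by [- (z + g a)]. The crude bound on
   [<y (k a), x>] gives 8, and [a^* g a], half of [<y a, y a>], gives 2; together 10. *)
rewrite -nk -nm_cstar_mul.
have qE : k *: a = - (z + cmul g a) by rewrite zE opprD opprK addrAC subrr add0r.
rewrite [X in cmul _ X]qE cmulNr nmN cmulDr.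
apply: le_trans (nmD _ _) _.
have h1 : nm (cmul (cstar (k *: a)) z) <= 8 * d * X ^+ 2.
  rewrite -inner_ractl; apply: le_trans (nm_inner_le4 _ _) _.
  have := ler_wpM2r X0 (ler_wpM2l (ltW d0) ya2).
  by rewrite ractZr nk -/X; lra.
have h2 : nm (cmul (cstar (k *: a)) (cmul g a)) <= 2 * d * X ^+ 2.
  rewrite cstarZ kJ scaleNr cmulNl nmN cmulZl nk.
  rewrite /g cmulZl cmulZr -yaE nmZr ?invr_ge0// nm_sqr.
  have : nm (ract y a) ^+ 2 <= (2 * X) ^+ 2 by rewrite lerXn2r// nnegrE ?nm_ge0//; lra.
  nra.
lra.
Qed.

(** As [g] is self-adjoint, [(g + i d) a = - <y,x>] is solvable for arbitrarily small [d > 0], and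
    the error [d |a|] is of order [sqrt d]. *)
Lemma cauchy_schwarz x y : nm (inner x y : A) <= nm x * nm y.
Proof.
pose g : A := (2^-1)%:C *: inner y y.
have gJ : cstar g = g by rewrite /g cstarZ conjc_real innerC.
have X0 := nm_ge0 x.
apply: le_eps => e e0.
have e0' : 0 < e ^+ 2 / (10 * nm x ^+ 2 + 1).
  by rewrite divr_gt0 ?exprn_gt0//; have := sqr_ge0 (nm x); lra.
have [||||d /andP[d0 de] /(_ (- inner y x))[a aE]] :=
    @resolvent_surj R A (cmul g) (nm g + 1) _ _ _ _ _ e0'.
- by have := nm_ge0 g; lra.
- by move=> a b; rewrite cmulDr cmulNr.
- by move=> a; apply: le_trans (nm_cmul _ _) _; rewrite ler_wpM2r ?nm_ge0//; lra.
- move=> d a; apply: nm_sub_add.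
  rewrite scalerA cstarZ conjc_imaginary cstarM gJ.
  by rewrite cmulZl cmulZr scaleNr -!cmulA subrr.
have [h1 h2] := cauchy_schwarz_approx d0 aE.
rewrite -innerC nm_cstar; apply: le_trans h1 _; rewrite lerD2l.
rewrite -(@ler_pXn2r _ 2) ?nnegrE ?mulr_ge0 ?nm_ge0 ?(ltW e0) ?(ltW d0)//.
apply: le_trans h2 _; move: de; rewrite ltr_pdivlMr; last by have := sqr_ge0 (nm x); lra.
nra.
Qed.

End Inner.

(** * Real sequences with geometric decay *)

Lemma le0_geometric (R : realType) (a K r : R) : 0 <= r -> r < 1 ->
  (forall n, a <= K * r ^+ n) -> a <= 0.
Proof.
move=> r0 r1 aK; have [K0|K0] := leP K 0.
  by have := aK 0%N; rewrite expr0 mulr1; lra.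
apply: le_eps => e e0; rewrite add0r.
have [N /(_ N (leqnn _))] := expr_lt_eps r0 r1 (divr_gt0 e0 K0).
by rewrite ltr_pdivlMr// => h; apply: le_trans (aK N) _; rewrite mulrC ltW.
Qed.

(** If the first ratio exceeded [r], all later ones would too, and [u] would outgrow [K * r ^+ n].
    Products replace quotients because [u] may vanish. *)
Lemma log_convex_le (R : realType) (u : nat -> R) (K r : R) : 0 <= r ->
  (forall n, 0 <= u n) -> (forall n, u n.+1 ^+ 2 <= u n * u n.+2) ->
  (forall n, u n.+1 <= K * r ^+ n) -> u 1%N <= r * u 0%N.
Proof.
move=> r0 u0 uconv uK.
(* Log-convexity: the ratios [u n.+1 / u n] are nondecreasing. *)
have ratio n : u 1%N * u n <= u 0%N * u n.+1.
  elim: n => [|n IH]; first by rewrite mulrC.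
  have := u0 n.+1; rewrite le0r => /orP[/eqP->|un]; first by rewrite mulr0 mulr_ge0.
  rewrite -(ler_pM2r un).
  have := ler_wpM2l (u0 1%N) (uconv n); have := ler_wpM2r (u0 n.+2) IH; lra.
have pow n : u 1%N ^+ n.+1 <= u 0%N ^+ n * u n.+1.
  elim: n => [|n IH]; first by rewrite expr0 mul1r expr1.
  rewrite exprS (le_trans (ler_wpM2l (u0 1%N) IH))// mulrCA exprSr -mulrA.
  by rewrite ler_wpM2l ?exprn_ge0.
rewrite leNgt; apply/negP => u1.
have u1_gt0 : 0 < u 1%N by apply: le_lt_trans u1; rewrite mulr_ge0.
suff : u 1%N <= 0 by rewrite leNgt u1_gt0.
apply: (@le0_geometric _ _ K (r * u 0%N / u 1%N)).
- by rewrite divr_ge0// mulr_ge0.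
- by rewrite ltr_pdivrMr// mul1r.
move=> n; rewrite expr_div_n mulrA ler_pdivlMr ?exprn_gt0// -exprS.
apply: le_trans (pow n) _; rewrite exprMn.
by have := ler_wpM2l (exprn_ge0 n (u0 0%N)) (uK n); lra.
Qed.

(** * Projections and the pointwise inequality *)

Section Projections.
Context {R : realType} {A : cstarAlgebraType R} {H : hilbertModuleType A}.
Implicit Types (P Q E F : H -> H) (x y z : H).

Lemma inner_ext x y : (forall z, inner x z = inner y z :> A) -> x = y.
Proof.
move=> xy; apply/eqP; rewrite -subr_eq0; apply/eqP/(@inner_eq0 R A).
by rewrite innerBl xy subrr.
Qed.

Section OneProjection.
Context {P} (hP : is_projection P).

Lemma proj_sym x y : inner (P x) y = inner x (P y) :> A.
Proof. by have [_ _] := hP. Qed.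

Lemma projK x : P (P x) = P x.
Proof. by have [_ PP _] := hP; rewrite -[LHS]/((P \o P) x) PP. Qed.

(** Linearity comes from self-adjointness, by testing against all vectors. *)
Lemma projB x y : P (x - y) = P x - P y.
Proof. by apply: inner_ext => z; rewrite proj_sym !innerBl !proj_sym. Qed.

Lemma projZ (t : R[i]) x : P (t *: x) = t *: P x.
Proof. by apply: inner_ext => z; rewrite proj_sym !innerZl proj_sym. Qed.

Lemma proj0 : P 0 = 0.
Proof. by rewrite -[in LHS](subrr (0 : H)) projB subrr. Qed.

Lemma inner_proj x : inner (P x) (P x) = inner x (P x) :> A.
Proof. by rewrite proj_sym projK. Qed.

Lemma nm_proj x : nm (P x) <= nm x.
Proof.
have := cauchy_schwarz x (P x); rewrite -inner_proj nm_sqr expr2.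
have := nm_ge0 (P x); rewrite le0r => /orP[/eqP-> _|p0]; first exact: nm_ge0.
by rewrite ler_pM2r.
Qed.

Lemma op_complK : op_compl (op_compl P) = P.
Proof. by apply/funext => x; rewrite /op_compl opprB addrC subrK. Qed.

Lemma op_compl_projection : is_projection (op_compl P).
Proof.
have sym : is_adjoint (op_compl P) (op_compl P).
  by move=> x y; rewrite innerBl innerBr proj_sym.
split=> //; first by exists (op_compl P).
by apply/funext => x /=; rewrite /op_compl projB projK subrr subr0.
Qed.

Lemma range_projE : range P = [set x | P x = x].
Proof.
by apply/seteqP; split=> [_ [x _ <-]|x Px]; [rewrite /= projK|exists x].
Qed.

End OneProjection.

Lemma null_op_compl P : is_projection P -> null_space (op_compl P) = range P.
Proof.
move=> hP; rewrite range_projE//; apply/seteqP; split=> x /=.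
  by move=> /eqP; rewrite subr_eq0 => /eqP.
by rewrite /null_space /op_compl /= => ->; rewrite subrr.
Qed.

Lemma range_op_compl P : is_projection P -> range (op_compl P) = null_space P.
Proof.
by move=> hP; rewrite -null_op_compl ?op_complK//; exact: op_compl_projection.
Qed.

Lemma nm_proj_pair_le P Q E F (s : R) :
  is_projection P -> is_projection Q -> is_projection E -> is_projection F ->
  range E = range P `&` range Q -> range F = null_space P `&` null_space Q ->
  0 <= s ->
  (forall x, nm (op_compl P (op_compl Q (op_compl F x))) <= s * nm x) ->
  forall x, nm (P (Q (op_compl E x))) <= s * nm x.
Proof.
move=> hP hQ hE hF rE rF s0 hs x.
have hP' := op_compl_projection hP; have hQ' := op_compl_projection hQ.
have hE' := op_compl_projection hE.
have pB := projB hP; have pK := projK hP; have psym := proj_sym hP.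
have qB := projB hQ; have qK := projK hQ; have qsym := proj_sym hQ.
set P' := op_compl P in hP' hs *; set Q' := op_compl Q in hQ' hs *.
set y := Q (op_compl E x).
have yx : nm y <= nm x := le_trans (nm_proj hQ _) (nm_proj hE' _).
have [s1|s1] := leP 1 s.
  apply: le_trans (nm_proj hP _) (le_trans yx _).
  by rewrite ler_peMl ?nm_ge0.
(* Unlike membership in [N(Q)], this orthogonality is preserved by both [P'] and [Q']. It forces
   [F z = 0], so [hs] applies without its last factor. *)
pose orthN z := forall m, P m = 0 -> Q m = 0 -> inner z m = 0 :> A.
have S1 z : Q z = 0 -> orthN z -> nm (P' z) <= s * nm z.
  move=> Qz Nz; have Fz : F z = 0.
    have : range F (F z) by exists z.
    rewrite rF => -[PF QF]; apply: (@inner_eq0 R A).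
    by rewrite (inner_proj hF) Nz.
  by have := hs z; rewrite /op_compl Fz subr0 /Q' /op_compl Qz subr0.
have Q'E z : Q z = 0 -> Q' z = z by rewrite /Q' /op_compl => ->; rewrite subr0.
have P'E z : P z = 0 -> P' z = z by rewrite /P' /op_compl => ->; rewrite subr0.
have QQ' z : Q (Q' z) = 0 by rewrite /Q' /op_compl qB qK subrr.
have PP' z : P (P' z) = 0 by rewrite /P' /op_compl pB pK subrr.
have NQ' z : orthN z -> orthN (Q' z).
  by move=> Nz m Pm Qm; rewrite (proj_sym hQ') Q'E// Nz.
have NP' z : orthN z -> orthN (P' z).
  by move=> Nz m Pm Qm; rewrite (proj_sym hP') P'E// Nz.
(* The bound [S1] by duality: [|w|^2 = <z, w> = <z, P' w> <= s |z| |w|]. *)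
have S2 z : P z = 0 -> orthN z -> nm (Q' z) <= s * nm z.
  move=> Pz Nz; set w := Q' z.
  have := cauchy_schwarz z (P' w).
  rewrite -(proj_sym hP') (P'E z)// /w -(inner_proj hQ') nm_sqr -/w => h.
  have := S1 w (QQ' z) (NQ' z Nz) => /(ler_wpM2l (nm_ge0 z)) /(le_trans h).
  have := nm_ge0 w; rewrite le0r => /orP[/eqP->|w0]; first by rewrite mulr_ge0 ?nm_ge0.
  by rewrite expr2 mulrCA mulrA ler_pM2r// mulrC.
pose r := s ^+ 2.
have r0 : 0 <= r by rewrite exprn_ge0.
have r1 : r < 1 by rewrite exprn_ilt1.
pose B u := Q (P (Q u)).
have symB u v : inner (B u) v = inner u (B v) :> A.
  by rewrite /B qsym psym qsym.
have QB u : Q (B u) = B u by rewrite /B qK.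
have BB u v : B (u - v) = B u - B v by rewrite /B qB pB qB.
have nm_B u : nm (B u) <= nm u.
  exact: le_trans (nm_proj hQ _) (le_trans (nm_proj hP _) (nm_proj hQ _)).
pose B' z := Q' (P' z).
pose X u := Q' (P u).
have S3 n z : Q z = 0 -> orthN z ->
    [/\ Q (iter n B' z) = 0, orthN (iter n B' z) &
        nm (iter n B' z) <= r ^+ n * nm z].
  move=> Qz Nz; elim: n => [|n [IH1 IH2 IH3]]; first by rewrite expr0 mul1r.
  split; [exact: QQ'|exact/NQ'/NP'|].
  have h1 := S2 (P' (iter n B' z)) (PP' _) (NP' _ IH2).
  have h2 := S1 _ IH1 IH2.
  apply: le_trans h1 _; apply: le_trans (ler_wpM2l s0 h2) _.
  by rewrite exprS mulrA -expr2 -mulrA ler_wpM2l.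
(* Since [P' Q' v = P Q v - Q v] for [v = P u], and [Q'] kills [Q v], both sides are [Q' P Q v]. *)
have XB u : Q u = u -> X (B u) = B' (X u).
  move=> Qu; rewrite /X /B /B' Qu; set v := P u.
  have -> : P' (Q' v) = P (Q v) - Q v.
    by rewrite /P' /Q' /op_compl pB [P v]pK opprB [LHS]addrC addrA subrK.
  by rewrite (projB hQ') [Q' (Q v)]/op_compl qK subrr subr0.
have BX u : Q u = u -> B u - B (B u) = Q (P (X u)).
  by move=> Qu; rewrite /B /X /Q' /op_compl Qu qK pB qB pK.
have NX u : orthN (X u).
  move=> m Pm Qm; by rewrite /X (proj_sym hQ') Q'E// psym Pm inner0r.
pose yn n := iter n B y.
have Qy : Q y = y by rewrite /y qK.
have Qyn n : Q (yn n) = yn n by case: n => [|n]; [exact: Qy|exact: QB].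
have Xyn n : X (yn n) = iter n B' (X y).
  by elim: n => //= n <-; rewrite XB.
(* [BX] controls differences only after one application of [B], so the convergent sequence is
   [yn n.+1]; hence the shifted index in [log_convex_le]. *)
have dyn n : nm (yn n.+2 - yn n.+1) <= nm (X y) * r ^+ n.
  rewrite nmBC /= BX// Xyn; have [_ _ h] := S3 n _ (QQ' (P y)) (NX y).
  by rewrite mulrC; apply: le_trans h; exact: le_trans (nm_proj hQ _) (nm_proj hP _).
have [l hl] := geometric_limit r0 r1 dyn.
set c := nm (X y) in hl.
have Bl : B l = l.
  apply/eqP; rewrite -subr_eq0; apply/eqP/nm_eq0/le_anti; rewrite nm_ge0 andbT.
  apply: (le0_geometric (K := c / (1 - r) * 2) r0 r1) => n.
  have := nmD (B (l - yn n.+1)) (yn n.+2 - l).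
  rewrite {1}BB addrA subrK => /le_trans; apply.
  have := nm_B (l - yn n.+1); have h1 := hl n; have := hl n.+1; rewrite nmBC.
  have : c * r ^+ n.+1 / (1 - r) <= c * r ^+ n / (1 - r).
    rewrite ler_pM2r ?invr_gt0; last by lra.
    by rewrite ler_wpM2l ?nm_ge0// exprS ler_piMl ?exprn_ge0// ltW.
  rewrite /= in h1 *; lra.
have yorth m : P m = m -> Q m = m -> inner y m = 0 :> A.
  move=> Pm Qm; rewrite /y qsym Qm (proj_sym hE').
  have : range E m by rewrite rE; split; exists m.
  by rewrite (range_projE hE) /op_compl => /= ->; rewrite subrr inner0r.
(* [B] is self-adjoint and fixes [m], so every [yn k] is orthogonal to [m], and this passes to the
   limit. *)
have lorth m : P m = m -> Q m = m -> inner l m = 0 :> A.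
  move=> Pm Qm; apply/nm_eq0/le_anti; rewrite nm_ge0 andbT.
  apply: (le0_geometric (K := c / (1 - r) * nm m) r0 r1) => n.
  have ynm k : inner (yn k) m = 0 :> A.
    by elim: k => [|k IH] /=; [exact: yorth|rewrite symB /B Qm Pm Qm].
  have := cauchy_schwarz (l - yn n.+1) m; rewrite innerBl ynm subr0 => /le_trans; apply.
  by apply: le_trans (ler_wpM2r (nm_ge0 m) (hl n)) _; lra.
(* [B l = l] and [Q l = l] give [<l, P l> = <l, l>], so [P' l] has zero inner square. Thus [l] lies
   in both ranges and is orthogonal to itself. *)
have l0 : l = 0.
  have Ql : Q l = l by rewrite -Bl QB.
  have Pl : P l = l.
    apply/eqP; rewrite eq_sym -subr_eq0; apply/eqP/(@inner_eq0 R A).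
    rewrite (inner_proj hP') innerBr.
    by rewrite -{3}Ql qsym -{4}Ql -/(B l) Bl subrr.
  by apply: (@inner_eq0 R A); rewrite lorth.
(* Log-convexity is Cauchy-Schwarz applied to [|B u|^2 = <u, B (B u)>]. *)
have By : nm (B y) <= r * nm y.
  apply: (@log_convex_le _ (fun n => nm (yn n)) (c / (1 - r)) r) => // n.
  - exact: nm_ge0.
  - by rewrite -nm_sqr /= symB; exact: cauchy_schwarz.
  - by have := hl n; rewrite l0 sub0r nmN; lra.
suff : nm (P y) <= s * nm y.
  by move=> /le_trans; apply; rewrite ler_wpM2l.
rewrite -(@ler_pXn2r _ 2) ?nnegrE ?mulr_ge0 ?nm_ge0//.
rewrite -nm_sqr (inner_proj hP).
have -> : inner y (P y) = inner y (B y) :> A by rewrite /B Qy -qsym Qy.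
apply: le_trans (cauchy_schwarz _ _) _; rewrite exprMn -/r.
by apply: le_trans (ler_wpM2l (nm_ge0 y) By) _; lra.
Qed.

End Projections.

(** * From pointwise bounds to operator norms *)

Section OperatorNorm.
Context {R : realType} {A : cstarAlgebraType R} {H : hilbertModuleType A}.
Implicit Types T : H -> H.

Lemma ball1E (x : H) : (`|x| <= 1) = (nm x <= 1).
Proof. by rewrite nmE -lecR rmorph1. Qed.

Lemma op_norm_le T (s : R) : 0 <= s ->
  (forall x, nm (T x) <= s * nm x) -> op_norm T <= s.
Proof.
move=> s0 Ts; apply: ge_sup.
  by exists (nm (T 0)); exists 0 => //=; rewrite normr0.
move=> _ [x x1 <-]; move: x1; rewrite /= ball1E => x1.
by apply: le_trans (Ts x) _; rewrite ler_piMr.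
Qed.

Section Contraction.
Context {T} (TZ : forall (t : R[i]) x, T (t *: x) = t *: T x)
  (T1 : forall x, nm (T x) <= nm x).

(** [T1] bounds the set of values by 1, so [sup] is a genuine upper bound and not its default
    value. *)
Lemma le_op_norm_ball x : nm x <= 1 -> nm (T x) <= op_norm T.
Proof.
move=> x1; apply: ub_le_sup; last by exists x => //=; rewrite ball1E.
by exists 1 => _ [z z1 <-]; move: z1; rewrite /= ball1E => z1; exact: le_trans (T1 z) z1.
Qed.

Lemma op_norm_ge0 : 0 <= op_norm T.
Proof.
apply: le_trans (nm_ge0 (T 0)) (le_op_norm_ball _).
by rewrite nm0.
Qed.

Lemma le_op_norm x : nm (T x) <= op_norm T * nm x.
Proof.
have := nm_ge0 x; rewrite le0r => /orP[/eqP x0|x0].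
  by have := T1 x; rewrite x0 mulr0.
rewrite -ler_pdivrMr// mulrC -nmZr ?invr_ge0 ?nm_ge0// -TZ.
apply: le_op_norm_ball.
by rewrite nmZr ?invr_ge0 ?nm_ge0// mulVf// gt_eqF.
Qed.

End Contraction.

Lemma op_norm_proj_pair_le (P Q E F : H -> H) :
  is_projection P -> is_projection Q -> is_projection E -> is_projection F ->
  range E = range P `&` range Q -> range F = null_space P `&` null_space Q ->
  op_norm (P \o Q \o op_compl E) <=
  op_norm (op_compl P \o op_compl Q \o op_compl F).
Proof.
move=> hP hQ hE hF rE rF.
have hP' := op_compl_projection hP; have hQ' := op_compl_projection hQ.
have hF' := op_compl_projection hF.
set T := op_compl P \o _ \o _.
have TZ (t : R[i]) x : T (t *: x) = t *: T x.
  by rewrite /T /= (projZ hF') (projZ hQ') (projZ hP').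
have T1 x : nm (T x) <= nm x.
  exact: le_trans (nm_proj hP' _) (le_trans (nm_proj hQ' _) (nm_proj hF' _)).
have T0 := op_norm_ge0 T1.
apply: op_norm_le => //; apply: (nm_proj_pair_le hP hQ hE hF) => // x.
exact: (le_op_norm TZ T1 x).
Qed.

End OperatorNorm.

Theorem theorem5p12 (R : realType) (A : cstarAlgebraType R)
    (H : hilbertModuleType A) (P Q : H -> H)
    (hP : is_projection P) (hQ : is_projection Q)
    (hR : orth_complemented (range P `&` range Q))
    (hN : orth_complemented (null_space P `&` null_space Q)) :
  op_norm (P \o Q \o op_compl (proj_on (range P `&` range Q))) =
  op_norm (op_compl P \o op_compl Q \o
             op_compl (proj_on (null_space P `&` null_space Q))).
Proof.
have hP' := op_compl_projection hP; have hQ' := op_compl_projection hQ.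
have rB (S T : H -> H) : is_projection S -> is_projection T ->
    forall x y, (range S `&` range T) x -> (range S `&` range T) y ->
    (range S `&` range T) (x - y).
  move=> hS hT x y; rewrite !range_projE// => -[/= Sx Tx] [/= Sy Ty].
  by split=> /=; rewrite projB// ?Sx ?Sy ?Tx ?Ty.
have r0 (S T : H -> H) : is_projection S -> is_projection T ->
    (range S `&` range T) 0.
  by move=> hS hT; rewrite !range_projE//; split; exact: proj0.
have [hE rE] := proj_onP (r0 _ _ hP hQ) (rB _ _ hP hQ) hR.
(* The null spaces are the ranges of the complements, so [r0] and [rB] cover them too. *)
move: (r0 _ _ hP' hQ') (rB _ _ hP' hQ'); rewrite !range_op_compl// => n0 nB.
have [hF rF] := proj_onP n0 nB hN.
apply/le_anti; rewrite (op_norm_proj_pair_le hP hQ hE hF rE rF) /=.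
(* For the complements, [E] and [F] trade places. *)
have := op_norm_proj_pair_le hP' hQ' hF hE.
by rewrite !range_op_compl// !null_op_compl// !op_complK; exact.
Qed.
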